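(* Let $G=(V,E)$ be a connected graph with chromatic number $\chi(G)=k+1$, where $k\ge 2$. Then for any maximum contrast greyscale $f$ of $G$, the set $\mathrm{Im}(f)$ is a $\frac1k$-minimum-step-enchained set, and $I_k\subset \mathrm{Im}(f)\subset F_k$ (inclusions not necessarily strict), where $I_k=\{\frac ik : i=0,1,\dots,k\}$.
   Context: Graphs are finite, undirected and simple. A greyscale of $G=(V,E)$ is a map $f:V\to[0,1]$ with $0,1\in \mathrm{Im}(f)$. For $e=\{u,v\}\in E$ put $\widehat f(e)=|f(u)-f(v)|$. The contrast vector $cont(G,f)$ is the vector of all values $\widehat f(e)$, $e\in E$, listed in ascending order; contrast vectors are compared lexicographically, and a maximum contrast greyscale is a greyscale whose contrast vector is the lexicographic maximum among all greyscales of $G$. For $r\ge 2$ and $p>0$, a $p$-step chain of length $r$ in $[0,1]$ is a sequence $[y_0,y_1,\dots,y_r]\subset[0,1]$ with $y_i-y_{i-1}=p$ for $i=1,\dots,r$; $y_0,y_r$ are its extreme points and the $y_i$ with $0<i<r$ are its interior points. A chain is in a set $F$ if all its points belong to $F$. A set $F\subset[0,1]$ is an $h$-minimum-step-enchained set if: (1) there is an $h$-step chain in $F$ with extreme points $0$ and $1$, and there is no $q$-step chain in $F$ with extreme points $0,1$ and $q<h$; (2) for every $y\in F-\{0,1\}$ there is a $p$-step chain in $F$, for some $p\ge h$, with extreme points $y_1,y_2$, having $y$ as an interior point, and such that, if $p>h$ and $y_i\notin\{0,1\}$ ($i=1$ or $2$), then $y_i$ is an interior point of a $q_i$-step chain in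 $F$ with $h\le q_i<p$. The set $F_k\subset[0,1]$ ($k\ge2$) is the set generated by the following recursive procedure. Start with $H=\{0,1\}$, where $0$ and $1$ carry the value $0$. Whenever $y_1<y_2$ are in $H$, $r\ge 2$ is an integer, $p=\frac{y_2-y_1}{r}\ge\frac1k$, and $p$ is strictly larger than the (smallest) values currently carried by $y_1$ and by $y_2$, add to $H$ all interior points $y_1+jp$ ($1\le j\le r-1$) of the $p$-step chain with extreme points $y_1,y_2$; each such interior point carries the value $p$ (the smallest such $p$, if it arises several times). Repeat as long as possible; $F_k$ is the set of all numbers so obtained. Equivalently: let $R$ be the smallest set of pairs of real numbers such that $(0,0),(1,0)\in R$ and, whenever $(y_1,q_1),(y_2,q_2)\in R$, $y_1<y_2$, $r\ge2$ is an integer, $p=\frac{y_2-y_1}{r}\ge\frac1k$ and $p>\max\{q_1,q_2\}$, then $(y_1+jp,\,p)\in R$ for $j=1,\dots,r-1$; then $F_k=\{y : (y,q)\in R \text{ for some } q\}$. *)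

(* Defs.v *)
From HB Require Import structures.
From mathcomp Require Import all_boot all_order all_algebra.
From mathcomp Require Import boolp classical_sets set_interval reals.

Set Implicit Arguments.
Unset Strict Implicit.
Unset Printing Implicit Defensive.

Import Order.TTheory GRing.Theory Num.Theory.
Local Open Scope classical_set_scope.
Local Open Scope ring_scope.

Record sgraph := SGraph {
  vertex :> finType;
  edge : rel vertex;
  edge_sym : symmetric edge;
  edge_irrefl : irreflexive edge }.

Definition connected_graph (G : sgraph) : Prop :=
  forall u v : G, connect (@edge G) u v.

Definition colorable (G : sgraph) (n : nat) : bool :=
  [exists c : {ffun G -> 'I_n},
    [forall u, forall v, edge u v ==> (c u != c v)]].

Lemma colorable_card (G : sgraph) : colorable G #|G|.
Proof.
apply/existsP; exists [ffun u => enum_rank u].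
apply/forallP => u; apply/forallP => v; apply/implyP => euv.
rewrite !ffunE; apply/negP => /eqP /enum_rank_inj uv.
by rewrite uv edge_irrefl in euv.
Qed.

Definition chromatic_number (G : sgraph) : nat :=
  ex_minn (ex_intro (colorable G) #|G| (colorable_card G)).

(* Each edge {u, v} is listed exactly once, oriented along the enumeration
   of the vertices. *)
Definition edges (G : sgraph) : seq (G * G) :=
  [seq e <- enum {: G * G} |
    edge e.1 e.2 && (enum_rank e.1 < enum_rank e.2)%N].

Section Greyscale.
Variables (R : realType) (G : sgraph).
Implicit Type f : G -> R.

Definition greyscale f : Prop :=
  [/\ range f `<=` `[0, 1], range f 0 & range f 1].

Definition contrast f (e : G * G) : R := `|f e.1 - f e.2|.

Definition contrast_vector f : seq R :=
  sort <=%R [seq contrast f e | e <- edges G].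

Definition le_lexi (s t : seq R) : bool :=
  ((s : seqlexi R) <= (t : seqlexi R))%O.

Definition maximum_contrast_greyscale f : Prop :=
  greyscale f /\
  forall g, greyscale g -> le_lexi (contrast_vector g) (contrast_vector f).

End Greyscale.

Section Enchained.
Variable R : realType.
Implicit Types (p q h y : R) (s : seq R) (F : set R).

(* The chain [y_0, ..., y_r] is the sequence s, of size r + 1. *)
Definition step_chain p s : Prop :=
  [/\ 0 < p, (2 < size s)%N, [set` s] `<=` `[0, 1] &
      forall i, (i.+1 < size s)%N -> s`_i.+1 - s`_i = p].

Definition chain_in F p s : Prop := step_chain p s /\ [set` s] `<=` F.

Definition extreme_points s y1 y2 : Prop := y1 = head 0 s /\ y2 = last 0 s.

Definition interior_point s y : Prop :=
  exists2 i, (0 < i < (size s).-1)%N & y = s`_i.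

Definition min_step_enchained h F : Prop :=
  [/\ F `<=` `[0, 1],
      (exists s, chain_in F h s /\ extreme_points s 0 1),
      (forall q s, q < h -> chain_in F q s -> ~ extreme_points s 0 1) &
      forall y, (F `\` [set 0; 1]) y ->
        exists p s y1 y2,
          [/\ h <= p, chain_in F p s, extreme_points s y1 y2,
              interior_point s y &
              h < p -> forall z, (z = y1 \/ z = y2) -> ~ [set 0; 1] z ->
                exists q t, [/\ h <= q < p, chain_in F q t &
                                interior_point t z]]].

(* [generated k y q]: the procedure produces the number y with value q. *)
Inductive generated (k : nat) : R -> R -> Prop :=
| generated0 : generated k 0 0
| generated1 : generated k 1 0
| generated_step y1 q1 y2 q2 (r j : nat) p :
    generated k y1 q1 -> generated k y2 q2 -> y1 < y2 -> (2 <= r)%N ->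
    p = (y2 - y1) / r%:R -> k%:R^-1 <= p -> Num.max q1 q2 < p -> (1 <= j <= r.-1)%N ->
    generated k (y1 + j%:R * p) p.

Definition F_ (k : nat) : set R := [set y | exists q, generated k y q].

Definition I_ (k : nat) : set R :=
  [set y | exists2 i : nat, (i <= k)%N & y = i%:R / k%:R].

End Enchained.

Arguments F_ : clear implicits.
Arguments I_ : clear implicits.

(* Main.v *)
(** A proper coloring with [k + 1] colors, rescaled to [0, 1], has all contrasts
at least [1/k], so every contrast of a maximum contrast greyscale [f] is at
least [1/k]; if [f] missed a level [i/k], rounding [k f] would color the graph
with [k] colors. For a level [y] of [f] other than [0] and [1], let [p] be the
least contrast of an edge touching that level: shifting the whole level slightly
up or down would improve [f] unless [p] is attained both towards [y + p] and
towards [y - p]. The least contrast at these neighboring levels is at most [p],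
so one may continue with step [p] in both directions until reaching [0], [1] or
a level with a strictly smaller least contrast. This is the required chain
through [y], and induction on [p] shows that [y] is generated with value [p]. *)

Require Import Defs.
From mathcomp Require Import all_boot all_order all_algebra.
From mathcomp Require Import boolp classical_sets set_interval reals.
From mathcomp Require Import ring lra zify.
Local Open Scope classical_set_scope.
Local Open Scope ring_scope.

Set Implicit Arguments.
Unset Strict Implicit.
Unset Printing Implicit Defensive.

Import Order.TTheory GRing.Theory Num.Theory.

Lemma sub_in_count (T : eqType) (a b : pred T) (s : seq T) :
  {in s, subpred a b} -> (count a s <= count b s)%N.
Proof.
move=> ab; rewrite (@eq_in_count _ a (predI a (mem s))); last first.
  by move=> x xs /=; rewrite xs andbT.
rewrite [leqRHS](@eq_in_count _ b (predI b (mem s))); last first.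
  by move=> x xs /=; rewrite xs andbT.
by apply: sub_count => x /= /andP[ax xs]; rewrite xs ab.
Qed.

(** * Lexicographic comparison of sorted sequences by counting small entries *)

Section LexiSort.
Context {R : realType}.
Implicit Types (s t : seq R) (p x y : R).

(** At the first difference [t] has [z < x], and no remaining entry of the sorted [s] is below [x].
    If [z <= p], the count at level [z] contradicts the hypothesis; otherwise no remaining entry of
    [s] is at most [p]. *)
Lemma le_lexi_count s t p : sorted <=%R s -> size s = size t -> le_lexi t s ->
  (forall y, y <= p -> (count (<= y)%R t <= count (<= y)%R s)%N) ->
  (count (<= p)%R s <= count (<= p)%R t)%N.
Proof.
elim: s t => [|x s IH] [|z t] //= sS [szE].
rewrite /le_lexi lexi_cons => /andP[zx /implyP xz] H.
have sS' : sorted <=%R s by apply: path_sorted sS.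
have sge w : w < x -> count (<= w)%R s = 0%N.
  move=> wx; apply/eqP; rewrite eqn0Ngt -has_count -all_predC.
  apply/allP => v vs /=; rewrite -ltNge.
  by apply: lt_le_trans wx _; have /allP := order_path_min le_trans sS; apply.
have [xz0|zltx] := leP x z.
  have zE : z = x by apply/le_anti; rewrite zx xz0.
  rewrite zE leq_add2l; apply: IH => //; first exact: xz.
  by move=> y /H; rewrite zE leq_add2l.
have [zp|pz] := leP z p.
  by have := H z zp; rewrite lexx (sge _ zltx) leNgt zltx.
by rewrite leNgt (lt_trans pz zltx) (sge _ (lt_trans pz zltx)).
Qed.

(** Criterion for refuting maximality of [a]: up to the threshold [p], [b] never has more small
    contrasts than [a], and at [p] it has strictly fewer because [e0] leaves the count. *)
Lemma sort_lexi_gt {T : eqType} (L : seq T) (a b : T -> R) p e0 :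
  (forall e, e \in L -> b e <= p -> a e <= b e) ->
  e0 \in L -> a e0 <= p < b e0 ->
  ~ le_lexi (sort <=%R (map b L)) (sort <=%R (map a L)).
Proof.
move=> H e0L /andP[ap pb] le_ba.
have sE (c : T -> R) y : count (<= y)%R (sort <=%R (map c L)) =
    count (fun e => (c e <= y)%R) L.
  by rewrite (permP (permEl (perm_sort _ _))) count_map.
have sub y e : y <= p -> e \in L -> b e <= y -> a e <= y.
  by move=> yp eL by_; apply: le_trans (H e eL (le_trans by_ yp)) by_.
have sz : size (sort <=%R (map a L)) = size (sort <=%R (map b L)).
  by rewrite !size_sort !size_map.
have cle y : y <= p ->
    (count (fun e => (b e <= y)%R) L <= count (fun e => (a e <= y)%R) L)%N.
  by move=> yp; apply: sub_in_count => e eL; apply: sub.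
have cge : (count (fun e => (a e <= p)%R) L <= count (fun e => (b e <= p)%R) L)%N.
  rewrite -(sE a) -(sE b).
  have sS := @sort_le_sorted _ _ (map a L).
  by apply: (le_lexi_count sS sz le_ba) => y yp; rewrite !sE; apply: cle.
move: cge; apply/negP; rewrite -ltnNge.
move: (perm_to_rem e0L) => /permP pL; rewrite !pL /= ap (leNgt (b e0)) pb /=.
rewrite add0n add1n ltnS; apply: sub_in_count => e /mem_rem eL /=.
by apply: sub.
Qed.

End LexiSort.

Lemma finite_gap {R : realType} {T : finType} (P : pred T) (F : T -> R) :
  (forall t, P t -> 0 < F t) -> exists2 e, 0 < e & forall t, P t -> e < F t.
Proof.
move=> F0; set m := \big[Num.min/1]_(t | P t) F t.
have m0 : 0 < m by apply: (big_ind (fun x => 0 < x)) => // x y x0 y0; rewrite lt_min x0.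
exists (m / 2); first by rewrite divr_gt0.
move=> t Pt; apply: lt_le_trans (_ : m <= _).
  by rewrite ltr_pdivrMr // ltr_pMr // ltr1n.
exact: bigmin_le_cond.
Qed.

(** * Colorings and the list of edges *)

Section Colorings.
Context {G : sgraph}.

Lemma colorableP n :
  reflect (exists2 c : G -> nat, (forall v, (c v < n)%N) &
             forall u v, edge u v -> c u <> c v)
          (colorable G n).
Proof.
apply: (iffP existsP) => [[c /forallP cP]|[c cn cP]].
  exists (fun v => c v : nat) => [v|u v euv cuv]; first exact: ltn_ord.
  have /forallP/(_ v) := cP u; rewrite euv /= => /eqP; apply.
  exact: val_inj.
exists [ffun v => Ordinal (cn v)]; apply/forallP => u; apply/forallP => v.
by apply/implyP => /cP; rewrite !ffunE => cuv; apply/eqP => -[].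
Qed.

Lemma chromatic_numberP n : chromatic_number G = n.+1 ->
  colorable G n.+1 /\ ~~ colorable G n.
Proof.
rewrite /chromatic_number; case: ex_minnP => m mP mmin mE; subst m; split=> //.
by apply/negP => /mmin; rewrite ltnn.
Qed.

Lemma edgesE e : (e \in edges G) =
  edge e.1 e.2 && (enum_rank e.1 < enum_rank e.2)%N.
Proof.
by rewrite mem_filter andb_idr // => _; rewrite [_ \in _]mem_enum.
Qed.

Lemma mem_edges (u v : G) :
  edge u v -> (u, v) \in edges G \/ (v, u) \in edges G.
Proof.
move=> euv; rewrite !edgesE /= (edge_sym v) euv /=.
case: ltngtP => [|| /ord_inj/enum_rank_inj uv]; [by left|by right|].
by rewrite uv edge_irrefl in euv.
Qed.

Lemma edge_edges e : e \in edges G -> edge e.1 e.2.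
Proof. by rewrite edgesE => /andP[]. Qed.

End Colorings.

(** * Lower bound on contrasts and the levels [i / k] *)

Section Contrast.
Context {R : realType} {G : sgraph}.
Implicit Types (f g : G -> R) (y p : R).

Lemma contrastC f u v : contrast f (u, v) = contrast f (v, u).
Proof. exact: distrC. Qed.

Lemma edges_cover (u v : G) : edge u v ->
  exists2 e, e \in edges G & forall f, contrast f e = `|f u - f v|.
Proof.
move=> /mem_edges[uv|vu]; first by exists (u, v).
by exists (v, u) => // f; rewrite contrastC.
Qed.

(** Since [k] colors do not suffice, both extreme colors occur: without color [0] all colors could
    be lowered by one, and without color [k] only [k] colors would remain. *)
Lemma exists_coloring_greyscale (k : nat) :
  (0 < k)%N -> chromatic_number G = k.+1 ->
  exists2 g : G -> R, greyscale g & forall u v, edge u v -> k%:R^-1 <= `|g u - g v|.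
Proof.
move=> k0 /chromatic_numberP[/colorableP[c cle cP] /negP ncol].
have kR0 : 0 < k%:R :> R by rewrite ltr0n.
exists (fun v => (c v)%:R / k%:R); last first.
  move=> u v /cP cuv; rewrite -mulrBl normrM (ger0_norm (x := k%:R^-1)) ?invr_ge0 ?ler0n//.
  rewrite ler_pMl ?invr_gt0// distrC.
  case: (ltngtP (c u) (c v)) cuv => // lt_c _.
    rewrite -natrB ?(ltnW lt_c)// normr_nat ler1n; lia.
  rewrite distrC -natrB ?(ltnW lt_c)// normr_nat ler1n; lia.
split.
- move=> _ [v _ <-]; rewrite /= in_itv /= divr_ge0 ?ler0n//=.
  by rewrite ler_pdivrMr // mul1r ler_nat -ltnS.
- apply: contrapT => no0; apply: ncol; apply/colorableP.
  have c0 v : (0 < c v)%N.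
    by rewrite lt0n; apply/eqP => cv; apply: no0; exists v; rewrite ?cv ?mul0r.
  exists (fun v => (c v).-1) => [v|u v /cP]; first by have := cle v; have := c0 v; lia.
  by have := c0 v; have := c0 u; lia.
- apply: contrapT => no1; apply: ncol; apply/colorableP; exists c => // v.
  rewrite ltn_neqAle -ltnS cle andbT; apply/eqP => cv; apply: no1.
  by exists v; rewrite ?cv ?divff// gt_eqF.
Qed.

Lemma max_contrast_ge (k : nat) f u v :
  (0 < k)%N -> chromatic_number G = k.+1 -> maximum_contrast_greyscale f ->
  edge u v -> k%:R^-1 <= `|f u - f v|.
Proof.
move=> k0 chi [_ fmax] euv; rewrite leNgt; apply/negP => fuv.
have [g gG gP] := exists_coloring_greyscale k0 chi.
have [e eL fe] := edges_cover euv.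
have gL d : d \in edges G -> contrast f e < contrast g d.
  by case: d => a b /edge_edges eab; rewrite fe; apply: lt_le_trans fuv (gP _ _ eab).
(* The threshold is the offending contrast itself: every contrast of [g] exceeds it, so the
   monotonicity condition is vacuous. *)
apply: (@sort_lexi_gt _ _ (edges G) (contrast f) (contrast g) (contrast f e) e _ eL) (fmax g gG).
  by move=> d /gL; rewrite ltNge => /negbTE->.
by rewrite lexx gL.
Qed.

Lemma truncn_sep (x y : R) : 0 <= x -> x + 1 <= y -> (Num.truncn x < Num.truncn y)%N.
Proof.
move=> x0 xy; have y0 : 0 <= y by lra.
have /andP[tx _] := truncn_itv x0.
by rewrite truncn_ge_nat // -natr1; lra.
Qed.

(* If the level [i / k] is missed, rounding [k * f] down below the gap and up
   above it, in the latter case minus one, only uses the colors [0, ..., k-1]. *)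
Lemma I_sub_range (k : nat) f : (0 < k)%N -> ~~ colorable G k ->
  range f `<=` `[0, 1] ->
  (forall u v, edge u v -> k%:R^-1 <= `|f u - f v|) -> I_ R k `<=` range f.
Proof.
move=> k0 /negP ncol f01 fge _ [i ik ->]; apply: contrapT => noi.
apply: ncol; apply/colorableP.
have kR0 : 0 < k%:R :> R by rewrite ltr0n.
have fb v : 0 <= f v <= 1 by have := f01 (f v) (imageT f v); rewrite /= in_itv.
pose x v := k%:R * f v.
have x0 v : 0 <= x v by rewrite mulr_ge0 ?ler0n//; case/andP: (fb v).
have xk v : x v <= k%:R by rewrite ger_pMr //; case/andP: (fb v).
have kx0 v : 0 <= k%:R - x v by rewrite subr_ge0.
have xi v : x v <> i%:R.
  move=> xv; apply: noi; exists v => //; rewrite -xv /x.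
  by rewrite mulrAC divff ?mul1r// gt_eqF.
have sep u v : edge u v -> x u + 1 <= x v \/ x v + 1 <= x u.
  move=> /fge; rewrite -[leLHS]mulr1 ler_pdivrMl // => H.
  have -> : x u = x v + k%:R * (f u - f v) by rewrite /x; ring.
  have [d0|d0] := leP 0 (f u - f v).
    by right; rewrite ger0_norm // in H; lra.
  by left; rewrite ltr0_norm // in H; lra.
(* The second branch is the ceiling of [x v] minus one, obtained by truncating the reflected value.
   As [x v] is not [i], that truncation is below [k - i], so the subtraction is exact and these
   colors are at least [i]. *)
pose c v := if x v < i%:R then Num.truncn (x v)
            else (k.-1 - Num.truncn (k%:R - x v))%N.
have clo v : x v < i%:R -> c v = Num.truncn (x v) /\ (c v < i)%N.
  by move=> xv; rewrite /c xv truncn_lt_nat.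
have chi v : i%:R <= x v -> c v = (k.-1 - Num.truncn (k%:R - x v))%N /\
    (Num.truncn (k%:R - x v) < k - i)%N.
  move=> xv; rewrite /c ltNge xv /= truncn_lt_nat // natrB //.
  by split=> //; have /eqP := xi v; rewrite neq_lt; lra.
have cdiff u v : x u + 1 <= x v -> (c u < c v)%N.
  move=> xuv; have [ui|iu] := ltP (x u) i%:R; have [vi|iv] := ltP (x v) i%:R.
  - by rewrite (clo _ ui).1 (clo _ vi).1 truncn_sep.
  - by have := clo _ ui; have := chi _ iv; lia.
  - by have := lt_le_trans vi iu; lra.
  - have := chi _ iu; have := chi _ iv.
    have := @truncn_sep (k%:R - x v) (k%:R - x u) (kx0 v).
    by move=> /(_ ltac:(lra)); lia.
exists c => [v|u v /sep[] /cdiff].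
- by have [/clo|/chi] := ltP (x v) i%:R; lia.
- lia.
- lia.
Qed.

End Contrast.

(** * The least contrast at a level and its two-sided attainment *)

Section LocalStep.
Context {R : realType} {G : sgraph}.
Implicit Types (f g : G -> R) (y p q : R).

Definition local_step f y p : Prop :=
  (exists u v, [/\ edge u v, f u = y & `|f u - f v| = p]) /\
  forall u v, edge u v -> f u = y -> p <= `|f u - f v|.

(** Connectedness and a second level give a vertex at level [y] a neighbor, so the minimum is over a
    nonempty finite set. *)
Lemma local_step_exists f y : connected_graph G -> range f y ->
  (exists v, f v <> y) -> exists p, local_step f y p.
Proof.
move=> conn [u _ fu] [w fw].
have [v euv] : exists v, edge u v.
  have /connectP[[|v s] /= us wE] := conn u w; first by rewrite wE in fw.
  by exists v; case/andP: us.
pose P (e : G * G) := edge e.1 e.2 && (f e.1 == y).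
have Puv : P (u, v) by rewrite /P /= euv fu /=.
case: (@arg_minP _ _ _ (u, v) P (contrast f) Puv) => -[a b] /andP[/= eab /eqP fa] H.
exists (contrast f (a, b)); split; first by exists a, b.
by move=> c d ecd fc; apply: (H (c, d)); rewrite /P /= ecd fc /=.
Qed.

(* Otherwise raising the whole level [y] slightly increases every contrast at
   that level equal to [p], and keeps all the larger ones above [p]. *)
Lemma local_step_up f y p : maximum_contrast_greyscale f -> 0 < p ->
  0 < y < 1 -> local_step f y p ->
  exists u v, [/\ edge u v, f u = y & f v = y + p].
Proof.
move=> [[f01 [u0 _ fu0] [u1 _ fu1]] fmax] p0 /andP[y0 y1].
move=> [[u [v [euv fu fuv]]] pmin]; apply: contrapT => noup.
pose P (e : G * G) := [&& edge e.1 e.2, f e.1 == y & y + p < f e.2].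
have [t t0 tP] : exists2 t, 0 < t & forall e, P e -> t < f e.2 - (y + p).
  by apply: finite_gap => e /and3P[_ _]; rewrite subr_gt0.
(* The bound [t] keeps neighbors above [y + p] farther than [p] from the raised level, and [1 - y]
   keeps that level in the unit interval. *)
pose e := Num.min t (1 - y).
have e0 : 0 < e by rewrite lt_min t0 subr_gt0.
have et : e <= t by rewrite ge_min lexx.
have ey : e <= 1 - y by rewrite ge_min lexx orbT.
pose g w := if f w == y then y + e else f w.
have up a b : edge a b -> f a = y -> y < f b -> p < `|y + e - f b|.
  move=> eab fa yb.
  have pb : y + p < f b.
    have := pmin _ _ eab fa; rewrite fa distrC gtr0_norm ?subr_gt0// => pb.
    rewrite lt_neqAle; apply/andP; split; last lra.
    by apply/eqP => fb; apply: noup; exists a, b.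
  have := tP (a, b); rewrite /P /= eab fa eqxx pb => /(_ isT) tb.
  by rewrite distrC gtr0_norm; lra.
have down w : w < y -> `|y + e - w| = `|y - w| + e.
  by move=> wy; rewrite !gtr0_norm; lra.
have gain a b : edge a b -> f a = y -> f b != y -> `|y + e - f b| <= p ->
    `|y - f b| <= `|y + e - f b|.
  move=> eab fa; rewrite neq_lt => /orP[/down->|/(up a b eab fa)]; first by lra.
  by rewrite ltNge => /negbTE->.
have gG : greyscale g.
  split.
  - move=> _ [w _ <-]; rewrite /= in_itv /g /=; case: eqP => [_|_]; first lra.
    by have := f01 (f w) (imageT f w); rewrite /= in_itv.
  - by exists u0; rewrite // /g fu0 lt_eqF.
  - by exists u1; rewrite // /g fu1 gt_eqF.
have [d dL dE] := edges_cover (R := R) euv.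
apply: (@sort_lexi_gt _ _ (edges G) (contrast f) (contrast g) p d _ dL) (fmax g gG).
  move=> [a b] /edge_edges /= eab; rewrite /contrast /g /=.
  case: eqP => fa; case: eqP => fb.
  - by rewrite fa fb !subrr.
  - by rewrite fa; apply: (gain a b) => //; apply/eqP.
  - rewrite fb !(distrC (f a)); apply: (gain b a) => //; last exact/eqP.
    by rewrite edge_sym.
  - by [].
(* An edge realizing [p] cannot go upwards, so it goes down and its contrast grows from [p] to
   [p + e]: this is the strict gain. *)
have fvy : f v < y.
  rewrite ltNge le_eqVlt; apply/negP => /orP[/eqP yv|yv].
    by move: fuv; rewrite fu -yv subrr normr0 => pE; rewrite -pE ltxx in p0.
  apply: noup; exists u, v; split=> //.
  by move: fuv; rewrite fu distrC gtr0_norm ?subr_gt0//; lra.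
rewrite !dE fuv lexx /= /g fu eqxx lt_eqF // down // -fu fuv; lra.
Qed.

(** * Reflection of greyscales *)

Definition flip f : G -> R := fun v => 1 - f v.

Lemma flip_contrast f : contrast (flip f) =1 contrast f.
Proof. by move=> e; rewrite /contrast distrC; congr `|_|; rewrite /flip; ring. Qed.

Lemma flip_greyscale f : greyscale f -> greyscale (flip f).
Proof.
move=> [f01 [u _ fu] [v _ fv]]; split.
- move=> _ [w _ <-]; have := f01 (f w) (imageT f w).
  by rewrite /= !in_itv /= /flip; lra.
- by exists v; rewrite // /flip fv subrr.
- by exists u; rewrite // /flip fu subr0.
Qed.

Lemma flip_maximum f : maximum_contrast_greyscale f ->
  maximum_contrast_greyscale (flip f).
Proof.
move=> [fG fmax]; split=> [|g gG]; first exact: flip_greyscale.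
by rewrite /contrast_vector (eq_map (flip_contrast f)); apply: fmax.
Qed.

Lemma flip_local_step f y p : local_step f y p -> local_step (flip f) (1 - y) p.
Proof.
have flipE u v : `|flip f u - flip f v| = `|f u - f v|.
  exact: (flip_contrast f (u, v)).
move=> [[u [v [euv fu fuv]]] pmin]; split.
  by exists u, v; split; rewrite ?flipE // /flip fu.
by move=> a b eab fa; rewrite flipE; apply: pmin => //; move: fa; rewrite /flip; lra.
Qed.

Lemma flip_local_stepE f z q : local_step (flip f) z q -> local_step f (1 - z) q.
Proof.
move=> /flip_local_step; congr (local_step _ _ _).
by apply/funext => v; rewrite /flip; ring.
Qed.

(** * Chains of constant step through a level *)

Definition chain_end f p z : Prop :=
  z = 0 \/ z = 1 \/ [/\ range f z, 0 < z < 1 & exists2 q, q < p & local_step f z q].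

Lemma chain_up f y p : connected_graph G -> maximum_contrast_greyscale f ->
  0 < p -> range f y -> 0 < y < 1 -> local_step f y p ->
  exists n, [/\ (0 < n)%N, forall j, (j <= n)%N -> range f (y + j%:R * p) &
                chain_end f p (y + n%:R * p)].
Proof.
move=> conn fmax p0.
have [f01 [u0 _ fu0] _] := fmax.1.
(* The climb ends because fewer than [N] steps of length [p] fit between [y] and [1]. *)
have [N] : exists N, 1 - y < N%:R * p.
  by exists (Num.truncn ((1 - y) / p)).+1; rewrite -ltr_pdivrMr // truncnS_gt.
elim: N y => [|N IH] y; first by rewrite mul0r => yN yF y01; lra.
rewrite -natr1 mulrDl mul1r => yN yF y01 yp.
have [u [v [euv fu fv]]] := local_step_up fmax p0 y01 yp.
have zF : range f (y + p) by exists v.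
have z01 : y + p <= 1.
  by have := f01 _ zF; rewrite /= in_itv => /andP[].
have one : chain_end f p (y + p) -> exists n, [/\ (0 < n)%N,
    forall j, (j <= n)%N -> range f (y + j%:R * p) & chain_end f p (y + n%:R * p)].
  exists 1%N; split; rewrite ?mul1r// => -[|[|//]] _; by rewrite ?mul0r ?addr0 ?mul1r.
have [z1|z1] := eqVneq (y + p) 1; first by apply: one; right; left.
have zlt : 0 < y + p < 1.
  by rewrite [y + p < 1]lt_neqAle z1 z01 andbT; lra.
have [q zq] : exists q, local_step f (y + p) q.
  by apply: local_step_exists => //; exists u0; rewrite fu0; lra.
(* The edge reaching [y + p] from [y] also competes for the minimum at [y + p]. *)
have : q <= p.
  have /(_ v u) := zq.2; rewrite edge_sym fv fu => /(_ euv erefl).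
  by rewrite addrC addKr gtr0_norm.
rewrite le_eqVlt => /orP[/eqP qp|qp]; last first.
  by apply: one; right; right; split=> //; exists q.
rewrite qp in zq; have [|n [n0 nF nE]] := IH (y + p) _ zF zlt zq; first lra.
have sh j : y + p + j%:R * p = y + j.+1%:R * p by rewrite -natr1; ring.
exists n.+1; split=> //; last by rewrite -sh.
by case=> [|j] jn; rewrite ?mul0r ?addr0// -sh; apply: nF.
Qed.

(** Reflection preserves contrasts, hence maximality and local steps, and turns an ascending chain
    into a descending one. *)
Lemma chain_down f y p : connected_graph G -> maximum_contrast_greyscale f ->
  0 < p -> range f y -> 0 < y < 1 -> local_step f y p ->
  exists n, [/\ (0 < n)%N, forall j, (j <= n)%N -> range f (y - j%:R * p) &
                chain_end f p (y - n%:R * p)].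
Proof.
move=> conn /flip_maximum fmax p0 [u _ fu] y01 /flip_local_step yp.
have unflip z : range (flip f) z -> range f (1 - z).
  by move=> [w _ <-]; exists w; rewrite // /flip; ring.
have [||n [n0 nF nE]] := chain_up conn fmax p0 _ _ yp.
- by exists u; rewrite // /flip fu.
- lra.
have sh j : 1 - (1 - y + j%:R * p) = y - j%:R * p by ring.
exists n; split=> //; first by move=> j /nF/unflip; rewrite sh.
rewrite -sh; case: nE => [->|[->|[zF z01 [q qp zq]]]].
- by right; left; rewrite subr0.
- by left; rewrite subrr.
- right; right; split; [exact: unflip|lra|].
  by exists q => //; apply: flip_local_stepE.
Qed.

Lemma chain_through f y p : connected_graph G -> maximum_contrast_greyscale f ->
  0 < p -> range f y -> 0 < y < 1 -> local_step f y p ->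
  exists a r j, [/\ (0 < j < r)%N, y = a + j%:R * p,
    forall i, (i <= r)%N -> range f (a + i%:R * p),
    chain_end f p a & chain_end f p (a + r%:R * p)].
Proof.
move=> conn fmax p0 yF y01 yp.
have [n [n0 nF nE]] := chain_up conn fmax p0 yF y01 yp.
have [m [m0 mF mE]] := chain_down conn fmax p0 yF y01 yp.
(* The two half-chains are glued at [y], which is interior since [m] and [n] are both positive. *)
exists (y - m%:R * p), (m + n)%N, m; split=> //.
- lia.
- by ring.
- move=> i imn; have [im|mi] := leqP i m.
    have := mF (m - i)%N (leq_subr _ _); rewrite natrB // mulrBl.
    by congr (range f _); ring.
  have := nF (i - m)%N; rewrite leq_subLR => /(_ imn); rewrite natrB ?(ltnW mi)//.
  by congr (range f _); ring.
- by move: nE; congr chain_end; rewrite natrD; ring.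
Qed.

Lemma local_step_generated (k : nat) f y p :
  (0 < k)%N -> connected_graph G -> maximum_contrast_greyscale f ->
  (forall u v, edge u v -> k%:R^-1 <= `|f u - f v|) ->
  range f y -> 0 < y < 1 -> local_step f y p -> generated k y p.
Proof.
move=> k0 conn fmax fge.
have kV : 0 < k%:R^-1 :> R by rewrite invr_gt0 ltr0n.
(* Induction on the real [p] becomes induction on this count: a smaller local step [q] is itself a
   contrast, so a pair attaining it is counted for [p] but not for [q]. *)
pose below q := #|[pred e : G * G | contrast f e < q]|.
have [N] := ubnP (below p); elim: N y p => // N IH y p pN yF y01 yp.
have pk : k%:R^-1 <= p by have [[u [v [euv _ <-]]] _] := yp; apply: fge.
have p0 : 0 < p by apply: lt_le_trans pk.
have [a [r [j [jr yE F aE bE]]]] := chain_through conn fmax p0 yF y01 yp.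
have gen z : chain_end f p z -> exists2 q, q < p & generated k z q.
  move=> [->|[->|[zF z01 [q qp zq]]]].
  - by exists 0 => //; apply: generated0.
  - by exists 0 => //; apply: generated1.
  - exists q => //; apply: IH => //; apply: leq_trans (_ : below p <= N)%N => //.
    apply: proper_card; apply/properP; split.
      by apply/fintype.subsetP => e; rewrite !inE => /lt_trans; apply.
    have [[u [v [euv _ fuv]]] _] := zq.
    by exists (u, v); rewrite !inE /contrast /= fuv ?ltxx.
have [qa qap aG] := gen _ aE; have [qb qbp bG] := gen _ bE.
rewrite yE; apply: (generated_step (r := r) aG bG _ _ _ pk) => //.
- by rewrite ltrDl mulr_gt0 // ltr0n; lia.
- lia.
- have r0 : r%:R != 0 :> R by rewrite pnatr_eq0; lia.
  by field.
- by rewrite gt_max qap qbp.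
- lia.
Qed.

(** * From indexed progressions to step chains *)

Lemma arithmetic_chain (F : set R) a p r : 0 < p -> (2 <= r)%N ->
  F `<=` `[0, 1] -> (forall i, (i <= r)%N -> F (a + i%:R * p)) ->
  let s := mkseq (fun i => a + i%:R * p) r.+1 in
  [/\ chain_in F p s, extreme_points s a (a + r%:R * p) &
      forall j, (0 < j < r)%N -> interior_point s (a + j%:R * p)].
Proof.
move=> p0 r2 F01 H s.
have sz : size s = r.+1 by rewrite size_mkseq.
have sE i : (i <= r)%N -> s`_i = a + i%:R * p by move=> ir; rewrite nth_mkseq.
have sF : [set` s] `<=` F.
  by move=> x /= /mapP[i]; rewrite mem_iota /= add0n ltnS => ir ->; apply: H.
split.
- split=> //; split=> //; first by rewrite sz.
    by move=> x /sF/F01.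
  by rewrite sz => i; rewrite ltnS => ir; rewrite sE // sE ?(ltnW ir) // -natr1; ring.
- split; last by rewrite -nth_last sz sE.
  by rewrite -nth0 sE // mul0r addr0.
- by move=> j jr; exists j; rewrite ?sz // sE //; lia.
Qed.

End LocalStep.

(** * Enchainment and the two inclusions *)

Theorem theorem4p4 (R : realType) (G : sgraph) (k : nat) (f : G -> R) :
  (2 <= k)%N -> connected_graph G -> chromatic_number G = k.+1 ->
  maximum_contrast_greyscale f ->
  min_step_enchained (k%:R^-1) (range f) /\
  I_ R k `<=` range f /\ range f `<=` F_ R k.
Proof.
move=> k2 conn chi fmax.
have k0 : (0 < k)%N by apply: ltnW.
have kR0 : 0 < k%:R :> R by rewrite ltr0n.
have h0 : 0 < k%:R^-1 :> R by rewrite invr_gt0.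
have h1 : k%:R^-1 <= 1 :> R by rewrite invf_le1 // ler1n.
have [f01 F0 F1] := fmax.1.
have fge u v : edge u v -> k%:R^-1 <= `|f u - f v|.
  exact: max_contrast_ge fmax.
have IF : I_ R k `<=` range f.
  exact: I_sub_range k0 (chromatic_numberP chi).2 f01 fge.
have interior y : range f y -> y <> 0 -> y <> 1 ->
    0 < y < 1 /\ exists2 p, k%:R^-1 <= p & local_step f y p.
  move=> yF y0 y1; split.
    have := f01 _ yF; rewrite /= in_itv /= => /andP[y0' y1'].
    by rewrite !lt_neqAle y0' y1' !andbT eq_sym; apply/andP; split; apply/eqP.
  have [|p yp] := local_step_exists conn yF.
    by case: F0 => u _ fu; exists u; rewrite fu => /esym.
  by exists p => //; have [[u [v [euv _ <-]]] _] := yp; apply: fge.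
have chains y p : range f y -> 0 < y < 1 -> k%:R^-1 <= p -> local_step f y p ->
    exists s a b, [/\ chain_in (range f) p s, extreme_points s a b,
      interior_point s y, chain_end f p a & chain_end f p b].
  move=> yF y01 hp yp; have p0 : 0 < p by apply: lt_le_trans hp.
  have [a [r [j [jr -> F aE bE]]]] := chain_through conn fmax p0 yF y01 yp.
  have [|sF sE sI] := arithmetic_chain p0 _ f01 F; first lia.
  by do 3!eexists; split; [exact: sF|exact: sE|exact: sI| |].
split; last split=> //.
  split=> //.
  - have H i : (i <= k)%N -> range f (0 + i%:R * k%:R^-1).
      by move=> ik; rewrite add0r; apply: IF; exists i.
    have [sF sE _] := arithmetic_chain h0 k2 f01 H.
    by eexists; split; [exact: sF|]; rewrite add0r divff ?gt_eqF in sE.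
  (* A chain from [0] with step [q] below [1/k] would make [q] a level. Its local step [p] is at
     least [1/k], so the descending chain from [q] would contain the negative level [q - p]. *)
  - move=> q s qh [[q0 ss _ sq] sF] [s0 s1].
    have s0q : s`_1 = q.
      by have := sq 0%N (ltnW ss); rewrite nth0 -s0 subr0.
    have qF : range f q by rewrite -s0q; apply: sF; rewrite /= mem_nth // ltnW.
    have [||/andP[_ q1] [p hp qp]] := interior q qF; [lra|lra|].
    have p0 : 0 < p by apply: lt_le_trans hp.
    have [m [m0 /(_ 1%N m0) mF _]] := chain_down conn fmax p0 qF (ltac:(lra)) qp.
    by have := f01 _ mF; rewrite /= in_itv /= mul1r; lra.
  - move=> y [yF y01]; have [||y01' [p hp yp]] := interior y yF.
    + by move=> y0; apply: y01; left.
    + by move=> y1; apply: y01; right.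
    have [s [a [b [sF sE sI aE bE]]]] := chains _ _ yF y01' hp yp.
    exists p, s, a, b; split=> // _ z zab z01.
    have : chain_end f p z by case: zab => ->.
    move=> [z0|[z1|[zF z01' [q qp zq]]]].
    + by case: z01; left.
    + by case: z01; right.
    have hq : k%:R^-1 <= q by have [[u [v [euv _ <-]]] _] := zq; apply: fge.
    (* An extreme point other than [0] and [1] is interior to the chain built from its own, smaller
       local step [q]. *)
    have [t [c [d [tF _ tI _ _]]]] := chains _ _ zF z01' hq zq.
    by exists q, t; split=> //; rewrite hq.
move=> y yF; have [->|/eqP y0] := eqVneq y 0; first by exists 0; apply: generated0.
have [->|/eqP y1] := eqVneq y 1; first by exists 0; apply: generated1.
have [y01 [p hp yp]] := interior y yF y0 y1.
by exists p; apply: local_step_generated yp.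
Qed.
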